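(* Let $k\ge 1$ and let $f:V^n\times\Omega\to V$ be of class $C^k$. Assume that the vector field $\underline{\Gamma}_f$ on $V^n\times\Omega$ satisfies the conditions of the center manifold theorem (with this $k$), so that its center manifold $M_c\subset V^n\times\Omega$ exists. Then the projection $P:V^n\times\Omega\to W_c\times\Omega$, $P(x,\lambda):=(P_c(x),\lambda)$, has the property that its restriction $P|_{M_c}$ bijectively conjugates $\underline{\Gamma}_f|_{M_c}$ to an ODE on $W_c\times\Omega$ of the form $$\dot x=R(x,\lambda),\qquad \dot\lambda=0.$$ Here $R:W_c\times\Omega\to W_c$ is a $C^k$ function satisfying: (i) $R(0,0)=0$; (ii) the center subspace of $DR_0(0)$ is the full space $W_c$, where $R_0:=R(\cdot,0):W_c\to W_c$ is the restriction of $R$ to $\{\lambda=0\}$; (iii) $R(A_{\sigma_i}x,\lambda)=A_{\sigma_i}R(x,\lambda)$ for all $i\in\{1,\dots,n\}$ and $(x,\lambda)\in W_c\times\Omega$, where $A_{\sigma_i}$ also denotes the restriction of $A_{\sigma_i}$ to $W_c$.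
   Context: $V$ is a finite-dimensional real vector space. $\Sigma=\{\sigma_1,\dots,\sigma_n\}$ is a set of $n$ distinct maps from $\{1,\dots,N\}$ to itself closed under composition, with $\sigma_1$ the identity. Write $V^n=\bigoplus_{\sigma_i\in\Sigma}V$ and define linear maps $A_{\sigma_i}:V^n\to V^n$ by $(A_{\sigma_i}X)_{\sigma_j}:=X_{\sigma_j\circ\sigma_i}$. The parameter space is $\Omega=\mathbb{R}^l$. For $f:V^n\times\Omega\to V$ with $f(0,0)=0$, define $\Gamma_f:V^n\times\Omega\to V^n$ by $\Gamma_f(x,\lambda)_{\sigma_i}:=f(A_{\sigma_i}x,\lambda)$, the vector field $\underline{\Gamma}_f:=(\Gamma_f,0)$ on $V^n\times\Omega$, and $\Gamma_{f,0}:=\Gamma_f(\cdot,0):V^n\to V^n$. The center (resp. hyperbolic) subspace of a linear map is the sum of the real generalized eigenspaces for eigenvalues on (resp. off) the imaginary axis. $W_c,W_h\subset V^n$ are the center and hyperbolic subspaces of $D\Gamma_{f,0}(0)$; they are invariant under all $A_{\sigma_i}$; $P_c:V^n\to W_c$ is the projection along $W_h$. Center manifold theorem (known). For every linear map $A$ of a finite-dimensional real vector space $E$, with center and hyperbolic subspaces $X_c,X_h$ and projections $\pi_c,\pi_h$ for $E=X_c\oplus X_h$, and every $k\ge1$, there is $\epsilon=\epsilon(A,k)>0$ (fixed once and for all) such that: if $F(x)=Ax+G(x)$ with $G$ of class $C^k$, $G(0)=0$, $DG(0)=0$, $\sup_x\|D^jG(x)\|<\infty$ for $0\le j\le k$ and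 $\sup_x\|DG(x)\|<\epsilon$, then there is a $C^k$ map $\psi:X_c\to X_h$ with $\psi(0)=0$, $D\psi(0)=0$ and $M_c:=\{x_c+\psi(x_c):x_c\in X_c\}=\{x:\sup_{t\in\mathbb{R}}\|\pi_h\phi^t(x)\|<\infty\}$, where $\phi^t$ is the flow of $\dot x=F(x)$. ''Satisfying the conditions of the center manifold theorem'' means that these hypotheses on $F$ hold; $M_c$ is called the center manifold of $F$. ''$P|_{M_c}$ bijectively conjugates $\underline{\Gamma}_f|_{M_c}$ to the ODE'' means: $P|_{M_c}:M_c\to W_c\times\Omega$ is a bijection and $P(\underline{\Gamma}_f(\underline{x}))=(R(P(\underline{x})),0)$ for all $\underline{x}\in M_c$. *)

(* Defs.v *)
From HB Require Import structures.
From mathcomp Require Import all_boot all_order all_algebra.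
From mathcomp Require Import boolp classical_sets functions reals topology.
From mathcomp Require Import normedtype derive.
From mathcomp Require Import complex.

Set Implicit Arguments.
Unset Strict Implicit.
Unset Printing Implicit Defensive.

Import Order.TTheory GRing.Theory Num.Theory.
Import numFieldNormedType.Exports.

Local Open Scope ring_scope.
Local Open Scope classical_set_scope.

(* A finite-dimensional vector space together with a norm. All norms being
   equivalent, the norm only serves to express limits, derivatives and bounds. *)
#[short(type="fdNormedModType")]
HB.structure Definition FDNormedModule (R : numFieldType) :=
  {V of NormedModule R V & Vector R V}.

HB.instance Definition _ (R : realType) (V W : fdNormedModType R) :=
  NormedModule.on (V * W)%type.

HB.instance Definition _ (R : realType) (m n : nat) :=
  NormedModule.on 'M[R]_(m, n).

Section FfunNorm.
Variables (R : realType) (I : finType) (V : fdNormedModType R).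
Implicit Types x y : {ffun I -> V}.

Definition ffun_norm x : R := \big[Num.max/0]_i `|x i|.

Lemma ffun_norm_ge x i : `|x i| <= ffun_norm x.
Proof. exact: le_bigmax. Qed.

Lemma ffun_norm_le x (c : R) :
  0 <= c -> (forall i, `|x i| <= c) -> ffun_norm x <= c.
Proof. by move=> c0 xc; apply/bigmax_leP; split. Qed.

Lemma ffun_norm_ge0 x : 0 <= ffun_norm x.
Proof. exact: bigmax_ge_id. Qed.

Lemma ler_ffun_normD x y : ffun_norm (x + y) <= ffun_norm x + ffun_norm y.
Proof.
apply: ffun_norm_le => [|i]; first by rewrite addr_ge0 // ffun_norm_ge0.
by rewrite ffunE (le_trans (ler_normD _ _)) // lerD // ffun_norm_ge.
Qed.

Lemma ler_ffun_normZ (a : R) x : ffun_norm (a *: x) <= `|a| * ffun_norm x.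
Proof.
apply: ffun_norm_le => [|i]; first by rewrite mulr_ge0 // ffun_norm_ge0.
by rewrite ffunE normrZ ler_wpM2l // ffun_norm_ge.
Qed.

Lemma ffun_normZ (a : R) x : ffun_norm (a *: x) = `|a| * ffun_norm x.
Proof.
apply/eqP; rewrite eq_le ler_ffun_normZ /=.
have [->|a0] := eqVneq a 0; first by rewrite normr0 mul0r ffun_norm_ge0.
rewrite -ler_pdivlMl ?normr_gt0 //.
by rewrite -[in leLHS](scalerK a0 x) -normfV ler_ffun_normZ.
Qed.

Lemma ffun_norm_eq0 x : ffun_norm x = 0 -> x = 0.
Proof.
move=> x0; apply/ffunP => i; rewrite ffunE; apply/eqP.
by rewrite -normr_le0 -x0 ffun_norm_ge.
Qed.

HB.instance Definition _ :=
  Lmodule_isNormed.Build R {ffun I -> V} ler_ffun_normD ffun_normZ ffun_norm_eq0.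

End FfunNorm.

Section SubvsNorm.
Variables (R : realType) (V : fdNormedModType R) (U : {vspace V}).
Implicit Types x y : subvs_of U.

Definition subvs_norm x : R := `|vsval x|.

Lemma ler_subvs_normD x y : subvs_norm (x + y) <= subvs_norm x + subvs_norm y.
Proof. by rewrite /subvs_norm linearD ler_normD. Qed.

Lemma subvs_normZ (a : R) x : subvs_norm (a *: x) = `|a| * subvs_norm x.
Proof. by rewrite /subvs_norm linearZ normrZ. Qed.

Lemma subvs_norm_eq0 x : subvs_norm x = 0 -> x = 0.
Proof. by move=> /normr0_eq0 x0; apply/val_inj; rewrite [LHS]x0 linear0. Qed.

HB.instance Definition _ :=
  Lmodule_isNormed.Build R (subvs_of U) ler_subvs_normD subvs_normZ subvs_norm_eq0.

End SubvsNorm.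

Section Smoothness.
Variables (R : realType) (E F : fdNormedModType R).
Implicit Types (f : E -> F) (x v : E).

(* In finite dimension, continuity of Df : E -> Hom(E, F) amounts to continuity
   of x |-> Df(x) v for every v, and similarly for higher derivatives. *)
Fixpoint Ck (k : nat) f : Prop :=
  if k is k'.+1 then
    (forall x, differentiable f x) /\ (forall v, Ck k' (fun x => 'd f x v))
  else continuous f.

(* The j-linear form D^j f(x)[v_1, ..., v_j], where j = size vs. *)
Fixpoint iter_diff (vs : seq E) f : E -> F :=
  if vs is v :: vs' then fun x => 'd (iter_diff vs' f) x v else f.

(* sup_x ||D^j f(x)|| < oo, with the operator norm of j-linear maps. *)
Definition bounded_iter_diff (j : nat) f : Prop :=
  exists C : R, forall x (vs : j.-tuple E),
    `|iter_diff vs f x| <= C * \prod_(v <- vs) `|v|.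

(* sup_x ||Df(x)|| < eps, with the operator norm. *)
Definition diff_norm_lt (eps : R) f : Prop :=
  exists2 c : R, c < eps & forall x v, `|'d f x v| <= c * `|v|.

Definition linearization f x : 'Hom(E, F) := linfun ('d f x).

End Smoothness.

Section SpectralSubspaces.
Variables (R : realType) (E : vectType R).
Implicit Types (A : 'End(E)) (mu : R[i]).

(* The complex eigenvalues of A, with multiplicity. *)
Definition eigenvalues A : seq R[i] :=
  sval (closed_field_poly_normal
    (map_poly (real_complex R)
      (char_poly (passmx.mxof (vbasis fullv) (vbasis fullv) A)))).

(* The real points of ker (A - mu)^d (+) ker (A - conj mu)^d, with d = dim E,
   that is, the kernel of ((A - mu) (A - conj mu))^d, where
   (A - mu) (A - conj mu) = (A - Re mu)^2 + (Im mu)^2. *)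
Definition real_gen_eigenspace A mu : {vspace E} :=
  let B := A - complex.Re mu *: \1%VF in
  let Q := (B \o B)%VF + (complex.Im mu ^+ 2) *: \1%VF in
  lker (iter (\dim {:E}) (comp_lfun Q) \1%VF).

Definition center_space A : {vspace E} :=
  (\sum_(mu <- eigenvalues A | complex.Re mu == 0%R) real_gen_eigenspace A mu)%VS.

Definition hyperbolic_space A : {vspace E} :=
  (\sum_(mu <- eigenvalues A | complex.Re mu != 0%R) real_gen_eigenspace A mu)%VS.

(* daddv_pi U W is the projection onto U along W. *)
Definition center_proj A : 'End(E) :=
  daddv_pi (center_space A) (hyperbolic_space A).

Definition hyperbolic_proj A : 'End(E) :=
  daddv_pi (hyperbolic_space A) (center_space A).

End SpectralSubspaces.

Section CenterManifold.
Variables (R : realType) (E : fdNormedModType R).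
Implicit Types (A : 'End(E)) (F : E -> E) (k : nat) (eps : R).

(* t |-> u t is the orbit t |-> phi^t(u 0) of the flow phi of x' = F(x). *)
Definition global_solution F (u : R -> E) : Prop :=
  forall t : R, is_derive t (1 : R) u (F (u t)).

(* The points whose orbit is defined for all times and has bounded
   hyperbolic component. *)
Definition center_manifold A F : set E :=
  [set x | exists u : R -> E, [/\ global_solution F u, u 0 = x &
     exists C : R, forall t, `|hyperbolic_proj A (u t)| <= C]].

(* The hypotheses of the center manifold theorem on F = A + G. *)
Definition center_manifold_conditions A k eps F : Prop :=
  let G := fun x => F x - A x in
  [/\ Ck k G,
      G 0 = 0,
      (forall v, 'd G 0 v = 0),
      (forall j, (j <= k)%N -> bounded_iter_diff j G) &
      diff_norm_lt eps G].

(* eps is a valid choice of the constant eps(A, k): the conclusion of the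
   center manifold theorem holds for all F satisfying its hypotheses. *)
Definition center_manifold_constant A k eps : Prop :=
  0 < eps /\
  forall F, center_manifold_conditions A k eps F ->
    exists psi : subvs_of (center_space A) -> subvs_of (hyperbolic_space A),
      [/\ Ck k psi, psi 0 = 0, (forall v, 'd psi 0 v = 0) &
          center_manifold A F = range (fun xc => vsval xc + vsval (psi xc))].

End CenterManifold.

Section Networks.
Variables (R : realType) (V : fdNormedModType R) (l N n : nat).
Variable sigma : 'I_n -> {ffun 'I_N -> 'I_N}.
Implicit Types f : {ffun 'I_n -> V} * 'rV[R]_l -> V.

(* The index of sigma_j \o sigma_i; the default value j is never used when
   the family sigma is closed under composition. *)
Definition comp_index (j i : 'I_n) : 'I_n :=
  odflt j [pick k | sigma k == [ffun m => sigma j (sigma i m)]].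

Definition Asigma (i : 'I_n) (X : {ffun 'I_n -> V}) : {ffun 'I_n -> V} :=
  [ffun j => X (comp_index j i)].

Definition Gamma f (xl : {ffun 'I_n -> V} * 'rV[R]_l) : {ffun 'I_n -> V} :=
  [ffun i => f (Asigma i xl.1, xl.2)].

Definition uGamma f (xl : {ffun 'I_n -> V} * 'rV[R]_l) :
    {ffun 'I_n -> V} * 'rV[R]_l :=
  (Gamma f xl, 0).

Definition DuGamma f : 'End(({ffun 'I_n -> V} * 'rV[R]_l)%type) :=
  linearization (uGamma f) 0.

Definition Gamma0 f (x : {ffun 'I_n -> V}) : {ffun 'I_n -> V} := Gamma f (x, 0).

Definition Wc f : {vspace {ffun 'I_n -> V}} :=
  center_space (linearization (Gamma0 f) 0).

Definition Pc f (x : {ffun 'I_n -> V}) : subvs_of (Wc f) :=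
  vsproj (Wc f) (center_proj (linearization (Gamma0 f) 0) x).

Definition projP f (xl : {ffun 'I_n -> V} * 'rV[R]_l) :
    subvs_of (Wc f) * 'rV[R]_l :=
  (Pc f xl.1, xl.2).

(* The restriction of Asigma i to Wc f. As Wc f is invariant under Asigma i,
   vsproj only casts Asigma i x to the type subvs_of (Wc f). *)
Definition AsigmaWc f (i : 'I_n) (x : subvs_of (Wc f)) : subvs_of (Wc f) :=
  vsproj (Wc f) (Asigma i (vsval x)).

End Networks.

(* Main.v *)
Require Import Defs.
From HB Require Import structures.
From mathcomp Require Import all_boot all_order all_algebra.
From mathcomp Require Import boolp classical_sets functions reals topology.
From mathcomp Require Import normedtype derive.
From mathcomp Require Import complex.
Import Order.TTheory GRing.Theory Num.Theory.
Import numFieldNormedType.Exports.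
Import passmx.
Local Open Scope ring_scope.
Local Open Scope classical_set_scope.

Set Implicit Arguments.
Unset Strict Implicit.
Unset Printing Implicit Defensive.

(** The linearization of the extended vector field at the origin is block
    triangular, with second block row zero; hence its hyperbolic space is
    [W_h x 0], which is exactly the kernel of the projection [P].  So [P] kills
    the graph part [psi] of a point of the center manifold and restricts to an
    isomorphism from the extended center space onto [W_c x Omega], whose inverse
    is [center_lift].  Pulling the vector field back along
    [center_lift w + psi (center_lift w)] gives a [C^k] field, whose linear part
    at [0] is the restriction of [D Gamma_0] to [W_c] because [D psi 0 = 0].
    Each [A_sigma] commutes with the vector field, hence with its linearization,
    the spectral projections and the flow, so it preserves the set of orbits
    with bounded hyperbolic part; equivariance of the reduced field follows.

    The spectral splitting is handled through annihilating polynomials: a vector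
    is in the center (hyperbolic) space iff it is killed by some nonzero
    polynomial in the map, all of whose complex roots are on (off) the imaginary
    axis.  This makes the spaces natural under all intertwining linear maps. *)

(** * Spectral subspaces *)

Section PolynomialsInEndomorphisms.
Variables (F : fieldType) (E : vectType F).
Implicit Types (A : 'End(E)) (p q : {poly F}) (v w : E).

(** Evaluation of [p] at [A], written with iterated composition: this makes sense in dimension 0 as
    well, and it matches the iteration in [real_gen_eigenspace]. *)
Definition lhorner A p : 'End(E) :=
  \sum_(i < size p) p`_i *: iter i (comp_lfun A) \1%VF.

Lemma lhorner_wide A p n : (size p <= n)%N ->
  lhorner A p = \sum_(i < n) p`_i *: iter i (comp_lfun A) \1%VF.
Proof.
move=> pn; rewrite /lhorner.
rewrite (big_ord_widen n (fun i => p`_i *: iter i (comp_lfun A) \1%VF)) //.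
rewrite big_mkcond; apply: eq_bigr => i _.
by case: ltnP => // pi; rewrite nth_default ?scale0r.
Qed.

Lemma lhorner_is_linear A : linear (lhorner A).
Proof.
move=> a p q; pose n := maxn (size p) (size q).
rewrite (@lhorner_wide _ p n) ?leq_maxl// (@lhorner_wide _ q n) ?leq_maxr//.
rewrite (@lhorner_wide _ _ n); last first.
  rewrite (leq_trans (size_polyD _ _)) // geq_max leq_maxr andbT.
  by rewrite (leq_trans (size_scale_leq _ _)) ?leq_maxl.
rewrite scaler_sumr -big_split; apply: eq_bigr => i _ /=.
by rewrite coefD coefZ scalerDl scalerA.
Qed.

HB.instance Definition _ A := GRing.isLinear.Build F {poly F} 'End(E) _
  (lhorner A) (lhorner_is_linear A).

Lemma lhornerC A c : lhorner A c%:P = c *: \1%VF.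
Proof.
by rewrite (@lhorner_wide _ _ 1) ?size_polyC_leq1// big_ord1 coefC.
Qed.

Lemma lhorner1 A : lhorner A 1 = \1%VF.
Proof. by rewrite (lhornerC A 1) scale1r. Qed.

Lemma lhornerMX A p : lhorner A (p * 'X) = (A \o lhorner A p)%VF.
Proof.
rewrite (@lhorner_wide _ _ (size p).+1) ?size_mulX_leq//; last first.
  have [->|p0] := eqVneq p 0; first by rewrite mul0r size_poly0.
  by rewrite size_mulX.
rewrite big_ord_recl coefMX scale0r add0r; apply/lfunP => v.
rewrite comp_lfunE !sum_lfunE linear_sum; apply: eq_bigr => i _.
by rewrite !scale_lfunE linearZ coefMX /= comp_lfunE.
Qed.

Lemma lhornerX A : lhorner A 'X = A.
Proof. by rewrite -['X]mul1r lhornerMX lhorner1 comp_lfun1r. Qed.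

Lemma lhornerM A p q v : lhorner A (p * q) v = lhorner A p (lhorner A q v).
Proof.
elim/poly_ind: p v => [|p c IH] v; first by rewrite mul0r linear0 !zero_lfunE.
rewrite mulrDl mulrAC !linearD /= !add_lfunE !lhornerMX !comp_lfunE IH.
by rewrite mul_polyC linearZ lhornerC !scale_lfunE id_lfunE.
Qed.

Lemma lhorner_exp A p m :
  lhorner A (p ^+ m) = iter m (comp_lfun (lhorner A p)) \1%VF.
Proof.
elim: m => [|m IH]; first by rewrite expr0 lhorner1.
by apply/lfunP => v; rewrite exprS lhornerM IH /= comp_lfunE.
Qed.

Lemma lhorner_dvdp A p q v : p %| q -> lhorner A p v = 0 -> lhorner A q v = 0.
Proof. by move=> /dvdpP[r ->] pv; rewrite lhornerM pv linear0. Qed.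

(** Bezout: if [a p + b q = 1], then [v] is the sum of [a(A) p(A) v] and [b(A) q(A) v], and both
    vanish. *)
Lemma lhorner_coprime_eq0 A p q v :
  coprimep p q -> lhorner A p v = 0 -> lhorner A q v = 0 -> v = 0.
Proof.
move=> /Bezout_eq1_coprimepP[[a b] /= ab] pv qv.
rewrite -[v]id_lfunE -(lhorner1 A) -ab linearD add_lfunE !lhornerM pv qv.
by rewrite !linear0 addr0.
Qed.

Lemma lhorner_coprime_split A p q v :
  coprimep p q -> lhorner A (p * q) v = 0 ->
  exists2 w, lhorner A p w = 0 & lhorner A q (v - w) = 0.
Proof.
(* With [a p + b q = 1], the component of [v] killed by [p] is [(b q)(A) v], and the remainder is
   [(a p)(A) v]. *)
move=> /Bezout_eq1_coprimepP[[a b] /= ab] pqv; exists (lhorner A (b * q) v).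
  by rewrite -lhornerM mulrCA lhornerM pqv linear0.
have -> : v - lhorner A (b * q) v = lhorner A (a * p) v.
  rewrite -[X in X - _]id_lfunE -(lhorner1 A) -ab linearD add_lfunE.
  by rewrite addrK.
by rewrite -lhornerM mulrCA [q * p]mulrC lhornerM pqv linear0.
Qed.

End PolynomialsInEndomorphisms.

Lemma lhorner_intertwine (F : fieldType) (E1 E2 : vectType F)
    (J : {linear E1 -> E2}) (A1 : 'End(E1)) (A2 : 'End(E2)) :
  (forall x, J (A1 x) = A2 (J x)) ->
  forall p x, J (lhorner A1 p x) = lhorner A2 p (J x).
Proof.
move=> JA; elim/poly_ind => [|p c IH] x.
  by rewrite !linear0 !zero_lfunE linear0.
rewrite !linearD /= !add_lfunE !lhornerMX !comp_lfunE linearD /= JA IH.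
by rewrite !lhornerC !scale_lfunE !id_lfunE linearZ.
Qed.

(** Cayley-Hamilton in the shape that [mxof] produces from [lhorner]: matrices act on row vectors,
    so composing with an endomorphism on the left becomes multiplying by its matrix on the right. *)
Lemma Cayley_Hamilton_sum (F : fieldType) n (M : 'M[F]_n) :
  \sum_(i < size (char_poly M)) (char_poly M)`_i *: iter i (mulmxr M) 1%:M = 0.
Proof.
case: n M => [|n] M; first by rewrite [LHS]flatmx0 [RHS]flatmx0.
rewrite -[RHS](Cayley_Hamilton M) -[in RHS](coefK (char_poly M)).
rewrite poly_def linear_sum; apply: eq_bigr => i _.
rewrite linearZ /= rmorphXn /= horner_mx_X; congr (_ *: _).
by elim: (i : nat) => [|j IH] /=; rewrite ?expr0// exprSr IH.
Qed.


Lemma Cayley_Hamilton_lfun (F : fieldType) (E : vectType F) (A : 'End(E)) :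
  lhorner A (char_poly (mxof (vbasis fullv) (vbasis fullv) A)) = 0.
Proof.
have e_basis := vbasisP {:E}.
set e := vbasis _ in e_basis *.
apply: (can_inj (mxofK e_basis e_basis)).
rewrite linear0 -[RHS](Cayley_Hamilton_sum (mxof e e A)).
rewrite /lhorner linear_sum; apply: eq_bigr => i _; rewrite linearZ.
congr (_ *: _).
elim: (i : nat) => [|j IH] /=; first by rewrite mxof1 ?(basis_free e_basis).
by rewrite (mxof_comp _ _ e_basis) IH.
Qed.

(** * Decomposition of the space along the complex spectrum *)

Section SpectralDecomposition.
Variables (R : realType).
Implicit Types (mu nu z : R[i]) (p q : {poly R}).

Local Notation toC := (map_poly (real_complex R)).

(** The real polynomial [(X - mu) (X - conj mu)]; for real [mu] it is the square of [X - mu]. *)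
Definition quad mu : {poly R} :=
  ('X - (complex.Re mu)%:P) ^+ 2 + (complex.Im mu ^+ 2)%:P.

Lemma quadC mu : toC (quad mu) = ('X - mu%:P) * ('X - (conjc mu)%:P).
Proof.
rewrite /quad rmorphD rmorphXn /= rmorphB /= map_polyX !map_polyC /=.
(* Replacing [(Im mu)^2] by [- (i Im mu)^2] turns [quad mu] into a difference of squares. *)
have -> : ((complex.Im mu ^+ 2)%:C%C)%:P = - (('i%C * (complex.Im mu)%:C%C)%:P) ^+ 2.
  rewrite -rmorphXn -rmorphN /=; congr (_%:P).
  by rewrite exprMn sqr_i mulN1r opprK rmorphXn.
rewrite subr_sqr; congr (_ * _).
  by rewrite -addrA -opprD -polyCD -complexE.
rewrite -[X in _ + X]opprK -addrA -opprD -polyCN -polyCD; congr ('X - _%:P).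
by case: mu => a b; simpc.
Qed.

Lemma root_quad mu z : root (toC (quad mu)) z = (z == mu) || (z == conjc mu).
Proof. by rewrite quadC rootM !root_XsubC. Qed.

Lemma quad_conj mu : quad (conjc mu) = quad mu.
Proof. by case: mu => a b; rewrite /quad /= sqrrN. Qed.

Lemma quad_neq0 mu : quad mu != 0.
Proof.
rewrite -(map_poly_eq0 (real_complex R)) quadC.
by rewrite mulf_neq0 ?polyXsubC_eq0.
Qed.

(** Coprimality can be tested over the complex numbers, and any root [z] of [quad nu'] determines
    it, since [quad nu' = quad z]. A common root thus forces equality. *)
Lemma coprimep_quad mu nu : quad mu != quad nu -> coprimep (quad mu) (quad nu).
Proof.
rewrite -(coprimep_map (real_complex R)) => munu.
apply/Pdiv.ClosedField.coprimepP => z.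
have quadE nu' : root (toC (quad nu')) z -> quad nu' = quad z.
  by rewrite root_quad => /orP[] /eqP ->; rewrite ?quad_conj.
by move=> /quadE muz; apply: contra munu => /quadE nuz; rewrite muz nuz.
Qed.

Variable E : vectType R.
Implicit Types (A : 'End(E)) (v : E) (s : seq R[i]).

Lemma real_gen_eigenspaceE A mu :
  real_gen_eigenspace A mu = lker (lhorner A (quad mu ^+ \dim {:E})).
Proof.
rewrite lhorner_exp /real_gen_eigenspace; set Q := (X in comp_lfun X).
suff <- : lhorner A (quad mu) = Q by [].
apply/lfunP => v; rewrite linearD /= lhornerC expr2 !add_lfunE lhornerM.
by rewrite comp_lfunE linearB /= lhornerX lhornerC.
Qed.

(* Eigenvalues may repeat, and conjugate ones have the same [quad]: all factors
   equal to the first one are grouped, and their power is split off from the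
   remaining product, to which it is coprime. *)
Lemma sumv_quad s A v m : (size s <= m)%N ->
  lhorner A (\prod_(mu <- s) quad mu) v = 0 ->
  v \in (\sum_(mu <- s) lker (lhorner A (quad mu ^+ m)))%VS.
Proof.
have [k] := ubnP (size s); elim: k s v => // k IH [|mu s] v.
  by rewrite !big_nil lhorner1 id_lfunE => _ _ ->; rewrite mem0v.
rewrite ltnS => sk sm.
pose same nu := quad nu == quad mu; pose s' := [seq nu <- mu :: s | ~~ same nu].
have mu_same : same mu by rewrite /same eqxx.
have prod_same (r : seq R[i]) :
    \prod_(nu <- r | same nu) quad nu = quad mu ^+ count same r.
  by rewrite (eq_bigr (fun=> quad mu)) ?big_const_seq ?iter_mulr_1 // => nu /eqP.
rewrite (bigID same) /= prod_same -big_filter -/s'.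
case/lhorner_coprime_split => [|w quadw s'w].
  apply: coprimep_expl; rewrite /s' big_filter.
  elim/big_ind: _ => [|p q cp cq|nu nuP]; first by rewrite coprimep1.
    by rewrite coprimepMr cp.
  by apply: coprimep_quad; rewrite eq_sym.
rewrite -[v](subrK w) (bigID same) /= addrC memv_add //.
  rewrite big_cons mu_same (subvP (addvSl _ _)) // memv_ker.
  apply/eqP; apply: lhorner_dvdp quadw; apply: dvdp_exp2l.
  by rewrite (leq_trans _ sm)// count_size.
have size_s' : (size s' <= size s)%N.
  by rewrite /s' /= mu_same size_filter count_size.
rewrite -big_filter -/s'; apply: IH => //.
  exact: leq_ltn_trans sk.
by rewrite (leq_trans size_s')// ltnW.
Qed.

Lemma eigenvaluesE A :
  toC (char_poly (mxof (vbasis fullv) (vbasis fullv) A)) =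
  \prod_(mu <- eigenvalues A) ('X - mu%:P).
Proof.
rewrite /eigenvalues; case: closed_field_poly_normal => s /= {1}->.
rewrite lead_coef_map (monicP (char_poly_monic _)) rmorph1 scale1r //.
Qed.

Lemma size_eigenvalues A : size (eigenvalues A) = \dim {:E}.
Proof.
apply: succn_inj; rewrite -(size_prod_XsubC (eigenvalues A) id) -eigenvaluesE.
by rewrite size_map_poly size_char_poly.
Qed.

(** Each factor [X - mu] of the characteristic polynomial divides [quad mu], so by Cayley-Hamilton
    the product of all [quad mu] kills every vector. There are [\dim {:E}] factors, which is the
    exponent used in the generalized eigenspaces. *)
Lemma sumv_eigenvalues A :
  (\sum_(mu <- eigenvalues A) real_gen_eigenspace A mu)%VS = fullv.
Proof.
apply/vspaceP => v; rewrite memvf.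
under eq_bigr do rewrite real_gen_eigenspaceE.
apply: sumv_quad; first by rewrite size_eigenvalues.
have /(congr1 (fun B : 'End(E) => B v)) := Cayley_Hamilton_lfun A.
rewrite zero_lfunE; apply: lhorner_dvdp.
rewrite -(dvdp_map (real_complex R)) eigenvaluesE rmorph_prod /=.
elim/big_ind2: _ => // [p1 q1 p2 q2|mu _]; first exact: dvdp_mul.
by rewrite quadC dvdp_mulr.
Qed.

(** Common form of [center_space] ([P] says that the real part is zero) and [hyperbolic_space] (the
    complement of that [P]). *)
Definition spectral_space (P : pred R[i]) A : {vspace E} :=
  (\sum_(mu <- eigenvalues A | P mu) real_gen_eigenspace A mu)%VS.

Definition spectrum_in (P : pred R[i]) p :=
  p != 0 /\ forall z, root (toC p) z -> P z.

Lemma spectrum_inM P p q :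
  spectrum_in P p -> spectrum_in P q -> spectrum_in P (p * q).
Proof.
move=> [p0 pP] [q0 qP]; split=> [|z]; first by rewrite mulf_neq0.
by rewrite rmorphM rootM => /orP[/pP|/qP].
Qed.

Lemma spectrum_in1 P : spectrum_in P 1.
Proof. by split=> [|z]; rewrite ?oner_neq0 // rmorph1 (negPf (root1 z)). Qed.

Lemma spectrum_inX P p m : spectrum_in P p -> spectrum_in P (p ^+ m).
Proof.
move=> pP; elim: m => [|m IH]; first exact: spectrum_in1.
by rewrite exprS; exact: spectrum_inM.
Qed.

Lemma spectrum_in_coprime P p q :
  spectrum_in P p -> spectrum_in (predC P) q -> coprimep p q.
Proof.
move=> [_ pP] [_ qP]; rewrite -(coprimep_map (real_complex R)).
apply/Pdiv.ClosedField.coprimepP => z /pP Pz.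
by apply/negP => /qP /=; rewrite Pz.
Qed.

(** The generalized eigenspaces are real, so that of [mu] also accounts for [conj mu]; [P] has to
    treat the two alike. *)
Definition conj_closed (P : pred R[i]) := forall z, P (conjc z) = P z.

Lemma spectral_space_kills P A v : conj_closed P -> v \in spectral_space P A ->
  exists2 p, spectrum_in P p & lhorner A p v = 0.
Proof.
move=> Pconj; rewrite /spectral_space.
elim/big_rec: _ v => [|mu U Pmu IH] v.
  rewrite memv0 => /eqP ->; exists 1; rewrite ?linear0 //.
  exact: spectrum_in1.
case/memv_addP => u; rewrite real_gen_eigenspaceE memv_ker => /eqP uE.
move=> [w /IH[p pP pw] ->].
exists (quad mu ^+ \dim {:E} * p).
  apply: spectrum_inM => //; apply: spectrum_inX; split; first exact: quad_neq0.
  by move=> z; rewrite root_quad => /orP[] /eqP ->; rewrite ?Pconj.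
rewrite linearD /= [X in _ + X]lhornerM pw linear0 addr0 mulrC lhornerM.
by rewrite uE linear0.
Qed.

Lemma spectral_spaceD P A :
  (spectral_space P A + spectral_space (predC P) A)%VS = fullv.
Proof. by rewrite -[RHS](sumv_eigenvalues A) (bigID P). Qed.

Lemma conj_closedC P : conj_closed P -> conj_closed (predC P).
Proof. by move=> Pconj z /=; rewrite Pconj. Qed.

(** A description free of the list of eigenvalues, so that it can be carried from one space to
    another. For the converse, split [v = u + w] along [P] and its complement: [w = v - u] is killed
    by [p * q], with roots in [P], and by [r], with roots outside, hence is zero. *)
Lemma mem_spectral_space P A v : conj_closed P ->
  v \in spectral_space P A <->
  exists2 p, spectrum_in P p & lhorner A p v = 0.
Proof.
move=> Pconj; split=> [|[p pP pv]]; first exact: spectral_space_kills.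
have : v \in (spectral_space P A + spectral_space (predC P) A)%VS.
  by rewrite spectral_spaceD memvf.
case/memv_addP => u uP [w wP vE].
have [q qP qu] := spectral_space_kills Pconj uP.
have [r rP rw] := spectral_space_kills (conj_closedC Pconj) wP.
suff -> : v = u by [].
suff w0 : w = 0 by rewrite vE w0 addr0.
apply: (lhorner_coprime_eq0 (spectrum_in_coprime (spectrum_inM pP qP) rP)) rw.
have -> : w = v - u by rewrite vE addrC addKr.
rewrite linearB /= [lhorner A _ u]lhornerM qu linear0 subr0 mulrC lhornerM.
by rewrite pv linear0.
Qed.

Lemma spectral_space_cap P A : conj_closed P ->
  (spectral_space P A :&: spectral_space (predC P) A = 0)%VS.
Proof.
move=> Pconj; apply/eqP; rewrite -subv0; apply/subvP => v.
rewrite memv_cap memv0 => /andP[/(mem_spectral_space _ _ Pconj)[p pP pv]].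
case/(mem_spectral_space _ _ (conj_closedC Pconj)) => q qP qv.
by apply/eqP; apply: lhorner_coprime_eq0 (spectrum_in_coprime pP qP) pv qv.
Qed.

End SpectralDecomposition.

(** * Center and hyperbolic projections *)

Section CenterHyperbolic.
Variable R : realType.

Definition imaginary : pred R[i] := fun z => complex.Re z == 0.

Lemma imaginary_conj : conj_closed imaginary.
Proof. by case. Qed.

Variable E : vectType R.
Implicit Types (A : 'End(E)) (v : E).

Lemma center_hyperbolic_cap A : (center_space A :&: hyperbolic_space A = 0)%VS.
Proof. exact: spectral_space_cap imaginary_conj. Qed.

Lemma center_hyperbolicD A v : center_proj A v + hyperbolic_proj A v = v.
Proof.
by rewrite daddv_pi_add ?center_hyperbolic_cap // spectral_spaceD memvf.
Qed.

Lemma sub_center_proj A v : v - center_proj A v = hyperbolic_proj A v.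
Proof. by rewrite -[X in X - _](center_hyperbolicD A v) addrC addKr. Qed.

Lemma center_proj_mem A v : center_proj A v \in center_space A.
Proof. exact: memv_pi. Qed.

Lemma hyperbolic_proj_mem A v : hyperbolic_proj A v \in hyperbolic_space A.
Proof. exact: memv_pi. Qed.

Lemma center_projP A v w :
  w \in center_space A -> v - w \in hyperbolic_space A -> center_proj A v = w.
Proof.
move=> wc vwh; apply/eqP; rewrite -subr_eq0 -memv0 -(center_hyperbolic_cap A).
rewrite memv_cap rpredB ?center_proj_mem //=.
have -> : center_proj A v - w = v - w - hyperbolic_proj A v.
  by rewrite -[X in _ = X - _ - _](center_hyperbolicD A) addrAC addrK.
by rewrite rpredB ?hyperbolic_proj_mem.
Qed.

End CenterHyperbolic.

(** * Naturality under intertwining maps *)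

Section Intertwining.
Variables (R : realType) (E1 E2 : vectType R) (J : {linear E1 -> E2}).
Variables (A1 : 'End(E1)) (A2 : 'End(E2)).
Hypothesis JA : forall x, J (A1 x) = A2 (J x).

Lemma spectral_space_intertwine P x : conj_closed P ->
  x \in spectral_space P A1 -> J x \in spectral_space P A2.
Proof.
move=> Pconj /(mem_spectral_space _ _ Pconj)[p pP px].
apply/mem_spectral_space => //; exists p => //.
by rewrite -(lhorner_intertwine JA) px linear0.
Qed.

Lemma spectral_space_intertwine_inj P x : conj_closed P -> injective J ->
  J x \in spectral_space P A2 -> x \in spectral_space P A1.
Proof.
move=> Pconj Jinj /(mem_spectral_space _ _ Pconj)[p pP px].
apply/mem_spectral_space => //; exists p => //; apply: Jinj.
by rewrite (lhorner_intertwine JA) px linear0.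
Qed.

(** [J] sends center space to center space and hyperbolic space to hyperbolic space, so it sends the
    splitting of [x] to that of [J x]. *)
Lemma center_proj_intertwine x : J (center_proj A1 x) = center_proj A2 (J x).
Proof.
apply/esym/center_projP.
  exact: spectral_space_intertwine (@imaginary_conj R) (center_proj_mem _ _).
rewrite -[x in J x](center_hyperbolicD A1) linearD addrC addKr.
apply: (spectral_space_intertwine (conj_closedC (@imaginary_conj R))).
exact: hyperbolic_proj_mem.
Qed.

Lemma hyperbolic_proj_intertwine x :
  J (hyperbolic_proj A1 x) = hyperbolic_proj A2 (J x).
Proof.
have := congr1 J (center_hyperbolicD A1 x).
rewrite linearD center_proj_intertwine -[RHS](center_hyperbolicD A2).
exact: addrI.
Qed.

End Intertwining.

(** * Smoothness in finite dimension *)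

Section FiniteDimensionalContinuity.
Variables (R : realType) (E : fdNormedModType R).

Local Notation e := (vbasis {:E}).

Lemma vecof_continuous : continuous (vecof e).
Proof.
move=> v; rewrite /vecof.
have cont_i i : {for v, continuous (fun r : 'rV[R]_(\dim {:E}) => r 0 i *: e`_i)}.
  apply: (@continuous_comp _ _ _ (fun r : 'rV[R]_(\dim {:E}) => r 0 i)
    (fun a => a *: e`_i)); [exact: coord_continuous|exact: scalel_continuous].
elim: (index_enum _) => [|i s IH].
  rewrite (_ : (fun _ => _) = cst 0); first exact: cst_continuous.
  by apply/funext => r; rewrite big_nil.
rewrite (_ : (fun _ => _) = (fun r : 'rV[R]_(\dim {:E}) => r 0 i *: e`_i) +
    (fun r => \sum_(j <- s) r 0 j *: e`_j)); last first.
  by apply/funext => r; rewrite big_cons.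
exact: continuousD (cont_i i) IH.
Qed.

Lemma norm_coord_le n (r : 'rV[R]_n) i : `|r 0 i| <= `|r|.
Proof.
rewrite [leRHS]mx_normrE.
exact: (le_bigmax _ (fun ij : 'I_1 * 'I_n => `|r ij.1 ij.2|) (0, i)).
Qed.

(** Half of the equivalence of norms: [c] is the minimum of [|vecof e r|] over the unit sphere,
    attained by compactness and positive because [vecof] is injective; homogeneity does the rest. *)
Lemma vecof_lower_bound :
  exists2 c : R, 0 < c & forall r, c * `|r| <= `|vecof e r|.
Proof.
pose S := [set r : 'rV[R]_(\dim {:E}) | `|r| = 1].
(* In dimension 0 the sphere is empty and has no minimum; there every [r] is zero. *)
have [S0|/set0P S0] := eqVneq S set0.
  exists 1 => // r; have [->|r0] := eqVneq r 0; first by rewrite normr0 mulr0.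
  have : S (`|r|^-1 *: r) by rewrite /S /= normrZ normfV normr_id mulVf ?normr_eq0.
  by rewrite S0.
have Scompact : compact S.
  apply: bounded_closed_compact.
    by exists 1; split=> // x x1 r /= ->; exact: ltW.
  have -> : S = (fun r : 'rV[R]_(\dim {:E}) => `|r|) @^-1` [set 1] by [].
  apply: closed_comp; last exact: closed_eq.
  by move=> r _; exact: norm_continuous.
have [|r0 r0S r0min] := @EVT_min_rV _ _ (fun r => `|vecof e r|) S S0 Scompact.
  apply: continuous_subspaceT => r.
  by apply: continuous_comp; [exact: vecof_continuous|exact: norm_continuous].
have eB := vbasisP {:E}.
exists `|vecof e r0|.
  rewrite normr_gt0 vecof_eq0 // -normr_eq0.
  by move: r0S; rewrite inE /S /= => ->; exact: oner_neq0.
move=> r; have [->|r0'] := eqVneq r 0; first by rewrite normr0 mulr0.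
rewrite -ler_pdivlMr ?normr_gt0 // mulrC -[X in X * _]ger0_norm ?invr_ge0 //.
rewrite -normrZ -linearZ; apply: r0min.
by rewrite inE /S /= normrZ normfV normr_id mulVf ?normr_eq0.
Qed.

Variable W : normedModType R.

Lemma linear_fd_continuous (f : {linear E -> W}) : continuous f.
Proof.
have [c c0 cP] := vecof_lower_bound.
apply/bounded_linear_continuous/linear_boundedP.
(* Expanding [x] in the basis gives this constant, each coordinate of [x] being at most
   [c^-1 * |x|]. *)
pose C := c^-1 * \sum_(i < \dim {:E}) `|f e`_i|.
near=> M => x; apply: (@le_trans _ _ (C * `|x|)); last first.
  by rewrite ler_wpM2r //; near: M; apply: nbhs_pinfty_ge; rewrite num_real.
have eB := vbasisP {:E}.
rewrite -{1}(rVofK eB x) /vecof linear_sum.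
rewrite (le_trans (ler_norm_sum _ _ _))// /C mulrAC mulr_sumr ler_sum // => i _.
rewrite linearZ normrZ ler_wpM2r //.
rewrite (le_trans (norm_coord_le _ _)) // ler_pdivlMl //.
by rewrite (le_trans (cP _)) // rVofK.
Unshelve. all: by end_near. Qed.

End FiniteDimensionalContinuity.

Section LinearDifferential.
Variables (R : realType) (E : fdNormedModType R) (W : normedModType R).

Lemma linear_fd_differentiable (f : {linear E -> W}) x : differentiable f x.
Proof. exact/linear_differentiable/linear_fd_continuous. Qed.

Lemma linear_fd_diff (f : {linear E -> W}) x : 'd f x = f :> (E -> W).
Proof. exact/diff_lin/linear_fd_continuous. Qed.

End LinearDifferential.

(** * Calculus of maps of class C^k *)

Section CkCalculus.
Variable R : realType.
Implicit Types E F G : fdNormedModType R.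

Lemma CkS_Ck E F k (f : E -> F) : Ck k.+1 f -> Ck k f.
Proof.
elim: k f => [|k IH] f [df Df]; first by move=> x; exact: differentiable_continuous.
by split=> // v; exact/IH/Df.
Qed.

Lemma Ck_le E F j k (f : E -> F) : (j <= k)%N -> Ck k f -> Ck j f.
Proof.
by move=> /subnK <-; elim: (k - j)%N => // m IH; rewrite addSn => /CkS_Ck.
Qed.

Lemma Ck_cst E F k (c : F) : Ck k (fun _ : E => c).
Proof.
elim: k c => [|k IH] c; first exact: cst_continuous.
split=> [x|v]; first exact: differentiable_cst.
rewrite (_ : (fun _ => _) = (fun _ => 0)); first exact: IH.
by apply/funext => x; rewrite (diff_cst c).
Qed.

Lemma Ck_linear E F k (f : {linear E -> F}) : Ck k f.
Proof.
case: k => [|k]; first exact: linear_fd_continuous.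
split=> [x|v]; first exact: linear_fd_differentiable.
rewrite (_ : (fun _ => _) = (fun _ => f v)); first exact: Ck_cst.
by apply/funext => x; rewrite linear_fd_diff.
Qed.

Lemma CkD E F k (f g : E -> F) : Ck k f -> Ck k g -> Ck k (fun x => f x + g x).
Proof.
elim: k f g => [|k IH] f g.
  by move=> cf cg x; exact: (continuousD (cf x) (cg x)).
move=> [df Df] [dg Dg]; split=> [x|v]; first exact: differentiableD.
rewrite (_ : (fun _ => _) = (fun x => 'd f x v + 'd g x v)).
  exact: (IH _ _ (Df v) (Dg v)).
by apply/funext => x; rewrite (diffD (df x) (dg x)).
Qed.

Lemma Ck_sum E F k (I : Type) (s : seq I) (f : I -> E -> F) :
  (forall i, Ck k (f i)) -> Ck k (fun x => \sum_(i <- s) f i x).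
Proof.
move=> fC; elim: s => [|i s IH].
  rewrite (_ : (fun _ => _) = (fun _ => 0)); first exact: Ck_cst.
  by apply/funext => x; rewrite big_nil.
rewrite (_ : (fun _ => _) = (fun x => f i x + \sum_(j <- s) f j x)).
  exact: CkD.
by apply/funext => x; rewrite big_cons.
Qed.

(** Seeing scaling as a bilinear map makes the product rule an instance of the differential of a
    bilinear map. *)
Lemma scale_bilinear F : bilinear_for
  (GRing.Scale.Law.clone _ _ *:%R _) (GRing.Scale.Law.clone _ _ *:%R _)
  (@GRing.scale R F : R^o -> F -> F).
Proof.
split=> [u'|u] a x y /=; first by rewrite scalerDl scalerA.
by rewrite scalerDr !scalerA mulrC.
Qed.

HB.instance Definition _ F := bilinear_isBilinear.Build R R^o F F _ _
  (@GRing.scale R F : R^o -> F -> F) (@scale_bilinear F).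

Section CoordScale.
Variables (U : normedModType R) (E F : fdNormedModType R).
Variables (a : U -> E) (c : U -> F) (i : 'I_(\dim {:E})).
Local Notation crd := (coord (vbasis {:E}) i).

Variable x : U.
Hypotheses (da : differentiable a x) (dc : differentiable c x).

Let scaleL : {bilinear R^o -> F -> F} := (@GRing.scale R F : R^o -> F -> F).

Lemma is_diff_coordZ : is_diff x (fun x => crd (a x) *: c x)
   (fun v => crd (a x) *: 'd c x v + crd ('d a x v) *: c x).
Proof.
pose crdL : {linear E -> R} := crd.
have dcrd : is_diff x (crdL \o a) (crdL \o 'd a x).
  apply: DiffDef.
    by apply: differentiable_comp => //; exact: linear_fd_differentiable.
  by rewrite diff_comp // ?linear_fd_diff //; exact: linear_fd_differentiable.
have dp := is_diff_pair dcrd (differentiableP dc).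
have scaleC : continuous (fun p : R^o * F => scaleL p.1 p.2).
  by move=> p; exact: scale_continuous.
have ds : is_diff ((crdL \o a) x, c x) (fun p : R^o * F => scaleL p.1 p.2)
    (fun q => scaleL (crdL (a x)) q.2 + scaleL q.1 (c x)).
  by apply: DiffDef; [exact: differentiable_bilin|rewrite diff_bilin].
exact: is_diff_comp dp ds.
Qed.

End CoordScale.

Lemma Ck_coordZ (U E F : fdNormedModType R) k (a : U -> E) (c : U -> F)
    (i : 'I_(\dim {:E})) :
  Ck k a -> Ck k c -> Ck k (fun x => coord (vbasis {:E}) i (a x) *: c x).
Proof.
elim: k a c => [|k IH] a c.
  move=> ca cc x; apply: cvgZ; last exact: cc.
  pose crdL : {linear E -> R} := coord (vbasis {:E}) i.
  have crdC : continuous crdL by exact: linear_fd_continuous.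
  exact: (continuous_comp (ca x) (crdC (a x))).
move=> aC cC; have [da Da] := aC; have [dc Dc] := cC.
split=> [x|v].
  by have [] := is_diff_coordZ i (da x) (dc x).
rewrite (_ : (fun _ => _) = (fun x => coord (vbasis {:E}) i (a x) *: 'd c x v +
    coord (vbasis {:E}) i ('d a x v) *: c x)); last first.
  by apply/funext => x; have [_ ->] := is_diff_coordZ i (da x) (dc x).
by apply: CkD; [exact: IH (CkS_Ck aC) (Dc v)|exact: IH (Da v) (CkS_Ck cC)].
Qed.

(** [Ck] speaks of differentials in a fixed direction, whereas the chain rule evaluates them in a
    direction that moves with [x]. Expanding that direction in a basis leaves fixed directions with
    moving scalar coefficients. *)
Lemma diff_coord_expansion (U E F : fdNormedModType R) (g : E -> F)
    (a : U -> E) y x :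
  'd g y (a x) =
  \sum_(i < \dim {:E}) coord (vbasis {:E}) i (a x) *: 'd g y (vbasis {:E})`_i.
Proof.
rewrite {1}(coord_vbasis (memvf (a x))) linear_sum.
by apply: eq_bigr => i _; rewrite linearZ.
Qed.

(** Induction on [k]: by the chain rule and the basis expansion, the derivative of the composite is
    a sum of products of the kind treated in [Ck_coordZ]. *)
Lemma Ck_comp (U E F : fdNormedModType R) k (f : U -> E) (g : E -> F) :
  Ck k f -> Ck k g -> Ck k (g \o f).
Proof.
elim: k f g => [|k IH] f g.
  by move=> cf cg x; exact: (continuous_comp (cf x) (cg (f x))).
move=> fC gC; have [df Df] := fC; have [dg Dg] := gC.
split=> [x|v]; first exact: differentiable_comp.
rewrite (_ : (fun _ => _) = (fun x => \sum_(i < \dim {:E})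
    coord (vbasis {:E}) i ('d f x v) *:
    ((fun y => 'd g y (vbasis {:E})`_i) \o f) x)); last first.
  apply/funext => x; rewrite diff_comp //=.
  exact: (diff_coord_expansion g (fun x => 'd f x v)).
apply: Ck_sum => i; apply: Ck_coordZ; first exact: Df.
exact: (IH _ _ (CkS_Ck fC) (Dg _)).
Qed.

End CkCalculus.

(** * Pulling a vector field back to a graph *)

Section PulledBackField.
Variables (R : realType) (W W' C H E X : fdNormedModType R).
Variables (iC : {linear C -> E}) (iH : {linear H -> E}).
Variables (S : {linear W -> C}) (Q : {linear X -> W'}).
Variables (G : E -> X) (psi : C -> H).

Let g z := iC z + iH (psi z).

(** The reduced field has this form: [iC] and [iH] are the inclusions of the center and hyperbolic
    spaces, [S] lifts to the center space, [G] is [Gamma] and [Q] is [Pc]. *)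
Lemma pulled_back_Ck k : Ck k G -> Ck k psi -> Ck k (fun w => Q (G (g (S w)))).
Proof.
move=> GC psiC.
have gC : Ck k g.
  by apply: CkD; [exact: Ck_linear|exact: Ck_comp psiC (Ck_linear k iH)].
have GgC := Ck_comp (Ck_comp (Ck_linear k S) gC) GC.
exact: Ck_comp GgC (Ck_linear k Q).
Qed.

Hypotheses (GC : Ck 1 G) (psiC : Ck 1 psi).
Hypotheses (psi0 : psi 0 = 0) (Dpsi0 : forall v, 'd psi 0 v = 0).

(** The graph is tangent to the center space at 0, so the term [iH (psi z)] contributes nothing to
    first order. *)
Lemma diff_pulled_back x :
  'd (fun w => Q (G (g (S w)))) 0 x = Q ('d G 0 (iC (S x))).
Proof.
have [dG _] := GC; have [dpsi _] := psiC.
have is_lin (E1 E2 : fdNormedModType R) (f : {linear E1 -> E2}) y : is_diff y f f.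
  by apply: DiffDef; [exact: linear_fd_differentiable|exact: linear_fd_diff].
have is_psi : is_diff (S 0) psi 0.
  rewrite linear0; apply: DiffDef; first exact: dpsi.
  by apply/funext => v; rewrite Dpsi0.
have is_g : is_diff (S 0) g iC.
  have is_Hpsi := is_diff_comp is_psi (is_lin _ _ iH _).
  apply: (is_diff_eq (is_diffD (is_lin _ _ iC _) is_Hpsi)).
  by apply/funext => v /=; rewrite fctE /= linear0 addr0.
have is_gS := is_diff_comp (is_lin _ _ S 0) is_g.
have gS0 : (g \o S) 0 = 0 by rewrite /= /g linear0 psi0 !linear0 addr0.
have is_G : is_diff ((g \o S) 0) G ('d G 0).
  by rewrite gS0; exact/differentiableP/dG.
have [_ dE] := is_diff_comp (is_diff_comp is_gS is_G) (is_lin _ _ Q _).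
exact: (congr1 (fun h : W -> W' => h x) dE).
Qed.

End PulledBackField.

(** * Equivariance and reduction *)

Section EquivariantVectorFields.
Variables (R : realType) (E : fdNormedModType R).
Variables (F : E -> E) (J : {linear E -> E}).
Hypothesis FJ : forall x, F (J x) = J (F x).

(** Differentiate [F \o J = J \o F] at 0 on both sides, using [J 0 = 0]. *)
Lemma diff_equivariant z : differentiable F 0 -> 'd F 0 (J z) = J ('d F 0 z).
Proof.
move=> dF; have dJ x : differentiable J x by exact: linear_fd_differentiable.
have dFJ : differentiable F (J 0) by rewrite linear0.
have dJE x w : 'd J x w = J w :=
  congr1 (fun h : E -> E => h w) (linear_fd_diff J x).
have dFJE : 'd (F \o J) 0 z = 'd F (J 0) ('d J 0 z) :=
  congr1 (fun h : E -> E => h z) (diff_comp (dJ 0) dFJ).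
have dJFE : 'd (J \o F) 0 z = 'd J (F 0) ('d F 0 z) :=
  congr1 (fun h : E -> E => h z) (diff_comp dF (dJ (F 0))).
have FJE : 'd (F \o J) 0 z = 'd (J \o F) 0 z.
  by congr ('d _ 0 z); apply/funext => x /=; rewrite FJ.
have J0E : 'd F (J 0) ('d J 0 z) = 'd F 0 (J z).
  exact: etrans (congr1 (fun y => 'd F y ('d J 0 z)) (linear0 J))
    (congr1 ('d F 0) (dJE 0 z)).
exact: etrans (etrans (esym J0E) (esym dFJE))
  (etrans FJE (etrans dJFE (dJE (F 0) ('d F 0 z)))).
Qed.

Lemma global_solution_equivariant u :
  global_solution F u -> global_solution F (J \o u).
Proof.
move=> uF t; have [du uFt] := uF t.
have du' : differentiable u t by exact/derivable1_diffP.
have dJ : differentiable J (u t) by exact: linear_fd_differentiable.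
have dJu : differentiable (J \o u) t by exact: differentiable_comp.
split; first exact: diff_derivable.
by rewrite deriveE // diff_comp //= linear_fd_diff -deriveE // uFt FJ.
Qed.

Variables (A : 'End(E)).
Hypothesis JA : forall x, J (A x) = A (J x).

(** [J] maps orbits to orbits and commutes with the hyperbolic projection; being Lipschitz, it keeps
    the hyperbolic component bounded. *)
Lemma center_manifold_equivariant x :
  center_manifold A F x -> center_manifold A F (J x).
Proof.
move=> [u [uF u0 [C uC]]]; exists (J \o u); split => /=.
- exact: global_solution_equivariant.
- by rewrite u0.
have [k k0 kJ] : exists2 k, k > 0 & forall x, `|J x| <= k * `|x|.
  exact/linear_lipschitz/linear_fd_continuous.
exists (k * C) => t; rewrite -(hyperbolic_proj_intertwine JA).
by rewrite (le_trans (kJ _)) // ler_pM2l.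
Qed.

End EquivariantVectorFields.

(** The zero map is annihilated by [X], whose only root lies on the imaginary axis. This will handle
    the parameter directions. *)
Lemma hyperbolic_space0 (R : realType) (E : vectType R) (v : E) :
  v \in hyperbolic_space 0%VF -> v = 0.
Proof.
move=> vh; apply/eqP; rewrite -memv0 -(center_hyperbolic_cap (0%VF : 'End(E))).
rewrite memv_cap vh andbT; apply/mem_spectral_space; first exact: imaginary_conj.
exists 'X; last by rewrite lhornerX zero_lfunE.
split; first by rewrite polyX_eq0.
by move=> z; rewrite map_polyX rootX => /eqP ->; rewrite /imaginary /=.
Qed.

(** * The network vector field and its symmetries *)

Definition pair0 (U W : zmodType) (x : U) : U * W := (x, 0).

Lemma pair0_is_linear (R : pzRingType) (U W : lmodType R) : linear (@pair0 U W).
Proof. by move=> a x y; congr (_, _); rewrite /= scaler0 addr0. Qed.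

HB.instance Definition _ (R : pzRingType) (U W : lmodType R) :=
  GRing.isLinear.Build R U (U * W)%type _ (@pair0 U W)
    (@pair0_is_linear R U W).

Definition ffun_single (I : finType) (V : zmodType) (i : I) (v : V) :
    {ffun I -> V} := [ffun j => if j == i then v else 0].

Lemma ffun_single_is_linear (R : pzRingType) (I : finType) (V : lmodType R) i :
  linear (@ffun_single I V i).
Proof.
move=> a x y; apply/ffunP => j; rewrite !ffunE.
by case: eqP => _ //; rewrite scaler0 addr0.
Qed.

HB.instance Definition _ (R : pzRingType) (I : finType) (V : lmodType R) i :=
  GRing.isLinear.Build R V {ffun I -> V} _ (@ffun_single I V i)
    (@ffun_single_is_linear R I V i).

Section NetworkVectorField.
Variables (R : realType) (V : fdNormedModType R) (l N n : nat).
Variable sigma : 'I_n -> {ffun 'I_N -> 'I_N}.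
Local Notation X := {ffun 'I_n -> V}.
Local Notation XO := ({ffun 'I_n -> V} * 'rV[R]_l)%type.

Lemma Asigma_is_linear i : linear (@Asigma R V N n sigma i).
Proof. by move=> a x y; apply/ffunP => j; rewrite !ffunE. Qed.

HB.instance Definition _ i :=
  GRing.isLinear.Build R X X _ (@Asigma R V N n sigma i) (Asigma_is_linear i).

Definition AsigmaO i (z : XO) : XO := (Asigma sigma i z.1, z.2).

Lemma AsigmaO_is_linear i : linear (AsigmaO i).
Proof. by move=> a x y; rewrite /AsigmaO !linearP. Qed.

HB.instance Definition _ i :=
  GRing.isLinear.Build R XO XO _ (AsigmaO i) (AsigmaO_is_linear i).

Hypothesis sigma_inj : injective sigma.
Hypothesis sigma_comp :
  forall i j, exists k, sigma k = [ffun m => sigma i (sigma j m)].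

Lemma sigma_comp_index j i :
  sigma (comp_index sigma j i) = [ffun m => sigma j (sigma i m)].
Proof.
rewrite /comp_index; case: pickP => [k /eqP //|none].
by have [k kE] := sigma_comp j i; have := none k; rewrite kE eqxx.
Qed.

(** At [m] the two sides read [x] at the indices of [(m j) i] and [m (j i)]. Composition is
    associative, and distinct indices carry distinct maps. *)
Lemma Asigma_comp j i (x : X) :
  Asigma sigma j (Asigma sigma i x) = Asigma sigma (comp_index sigma j i) x.
Proof.
apply/ffunP => m; rewrite !ffunE; congr (x _); apply: sigma_inj.
by apply/ffunP => p; rewrite !sigma_comp_index !ffunE.
Qed.

Variable f : XO -> V.

(** In component [j], the left side evaluates [f] at [A_j A_i x] and the right side at
    [A_(j i) x]. *)
Lemma Gamma_equivariant i z :
  Gamma sigma f (AsigmaO i z) = Asigma sigma i (Gamma sigma f z).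
Proof. by apply/ffunP => j; rewrite !ffunE Asigma_comp. Qed.

Lemma uGamma_equivariant i z :
  uGamma sigma f (AsigmaO i z) = AsigmaO i (uGamma sigma f z).
Proof. by rewrite /uGamma Gamma_equivariant. Qed.

Lemma uGammaE : uGamma sigma f = @pair0 X 'rV[R]_l \o Gamma sigma f.
Proof. by []. Qed.

Lemma Gamma_Ck k : Ck k f -> Ck k (Gamma sigma f).
Proof.
(* [Gamma] is the sum over [i] of [f] precomposed with the linear map [AsigmaO i] and put into the
   [i]-th summand. *)
move=> fC; rewrite (_ : Gamma sigma f = (fun z => \sum_(i < n)
    (ffun_single i \o (f \o AsigmaO i)) z)).
  apply: Ck_sum => i; have fA := Ck_comp (Ck_linear k (AsigmaO i)) fC.
  exact: (Ck_comp fA (Ck_linear k (ffun_single i : {linear V -> X}))).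
apply/funext => z; apply/ffunP => j; rewrite sum_ffunE (bigD1 j) //= !ffunE eqxx.
by rewrite big1 ?addr0 // => i ij; rewrite ffunE eq_sym (negPf ij).
Qed.

Hypothesis f_diff : Ck 1 f.

Lemma Gamma_differentiable z : differentiable (Gamma sigma f) z.
Proof. by have [] := Gamma_Ck f_diff. Qed.

Lemma uGamma_differentiable z : differentiable (uGamma sigma f) z.
Proof.
rewrite uGammaE; apply: differentiable_comp; first exact: Gamma_differentiable.
exact: linear_fd_differentiable.
Qed.

Local Notation A := (DuGamma sigma f).
Local Notation L := (linearization (Gamma0 sigma f) 0).

Lemma DuGammaE z : A z = ('d (Gamma sigma f) 0 z, 0).
Proof.
rewrite lfunE uGammaE diff_comp; first by rewrite /= linear_fd_diff.
  exact: Gamma_differentiable.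
exact: linear_fd_differentiable.
Qed.

Lemma DGamma0E x : L x = 'd (Gamma sigma f) 0 (x, 0).
Proof.
pose J : {linear X -> XO} := @pair0 X 'rV[R]_l; have J0 : J 0 = 0 by [].
have dJ : differentiable J 0 by exact: linear_fd_differentiable.
have dG : differentiable (Gamma sigma f) (J 0) by exact: Gamma_differentiable.
rewrite lfunE (_ : Gamma0 sigma f = Gamma sigma f \o J) // (diff_comp dJ dG).
by rewrite /= (linear_fd_diff J) J0.
Qed.

Lemma DuGamma_equivariant i z : AsigmaO i (A z) = A (AsigmaO i z).
Proof.
rewrite !lfunE; apply/esym/diff_equivariant; first exact: uGamma_equivariant.
exact: uGamma_differentiable.
Qed.

Lemma DGamma0_equivariant i x : Asigma sigma i (L x) = L (Asigma sigma i x).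
Proof.
have := congr1 fst (DuGamma_equivariant i (x, 0)).
by rewrite !DGamma0E !DuGammaE.
Qed.

(** Two intertwinings suffice: the injection [x |-> (x, 0)] between [L] and [A], and the second
    projection between [A] and the zero map, whose hyperbolic space is trivial. *)
Lemma hyperbolic_space_DuGamma z :
  (z \in hyperbolic_space A) = (z.1 \in hyperbolic_space L) && (z.2 == 0).
Proof.
have nonimC := conj_closedC (@imaginary_conj R).
have pairL x : @pair0 X 'rV[R]_l (L x) = A (pair0 _ x).
  by rewrite DuGammaE DGamma0E.
apply/idP/andP => [zh|[z1h /eqP z20]]; last first.
  rewrite (surjective_pairing z) z20.
  exact: (spectral_space_intertwine pairL nonimC z1h).
have z20 : z.2 = 0.
  apply: hyperbolic_space0; apply: (spectral_space_intertwine _ nonimC zh).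
  by move=> x; rewrite DuGammaE zero_lfunE.
split; last exact/eqP.
apply: (spectral_space_intertwine_inj pairL nonimC); first by move=> x y [].
by case: z z20 zh => z1 z2 /= ->.
Qed.

End NetworkVectorField.

(** * The center space of the extended field and the projection [P] *)

Section CenterReduction.
Variables (R : realType) (V : fdNormedModType R) (l N n : nat).
Variable sigma : 'I_n -> {ffun 'I_N -> 'I_N}.
Local Notation X := {ffun 'I_n -> V}.
Local Notation O := 'rV[R]_l.
Local Notation XO := ({ffun 'I_n -> V} * 'rV[R]_l)%type.
Hypothesis sigma_inj : injective sigma.
Hypothesis sigma_comp :
  forall i j, exists k, sigma k = [ffun m => sigma i (sigma j m)].
Variable f : XO -> V.
Hypothesis f_diff : Ck 1 f.

Local Notation A := (DuGamma sigma f).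
Local Notation L := (linearization (Gamma0 sigma f) 0).
Local Notation Wcf := (subvs_of (Wc sigma f)).
Local Notation Xc := (subvs_of (center_space A)).

Lemma Pc_is_linear : linear (@Pc R V l N n sigma f).
Proof. by move=> a x y; rewrite /Pc !linearP. Qed.

HB.instance Definition _ :=
  GRing.isLinear.Build R X Wcf _ (@Pc R V l N n sigma f) Pc_is_linear.

Lemma projP_is_linear : linear (@projP R V l N n sigma f).
Proof. by move=> a x y; rewrite /projP !linearP. Qed.

HB.instance Definition _ :=
  GRing.isLinear.Build R XO (Wcf * O)%type _ (@projP R V l N n sigma f)
    projP_is_linear.

Lemma val_Pc x : vsval (Pc sigma f x) = center_proj L x.
Proof. by rewrite /Pc vsprojK // center_proj_mem. Qed.

Lemma projP_hyperbolic z : z \in hyperbolic_space A -> projP sigma f z = 0.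
Proof.
rewrite (hyperbolic_space_DuGamma sigma f_diff) => /andP[z1h /eqP z20].
rewrite /projP z20; congr (_, _); apply: val_inj; rewrite /= val_Pc.
by apply: center_projP; rewrite ?mem0v ?subr0.
Qed.

(** The point [(x, lambda)] itself need not lie in the center space of [A]. Projecting it there
    changes it only by an element of [W_h x 0], which [P] kills; this gives the inverse of [P] on
    the center space. *)
Definition center_lift (w : Wcf * O) : Xc :=
  vsproj (center_space A) (center_proj A (vsval w.1, w.2)).

Lemma center_lift_is_linear : linear center_lift.
Proof.
move=> a x y; rewrite /center_lift.
by rewrite -!linearP /=; congr (vsproj _ (center_proj _ (_, _))); rewrite linearP.
Qed.

HB.instance Definition _ :=
  GRing.isLinear.Build R (Wcf * O)%type Xc _ center_lift center_lift_is_linear.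

Lemma val_center_lift w : vsval (center_lift w) = center_proj A (vsval w.1, w.2).
Proof. by rewrite vsprojK // center_proj_mem. Qed.

Lemma projP_center_lift w : projP sigma f (vsval (center_lift w)) = w.
Proof.
have := congr1 (projP sigma f) (center_hyperbolicD A (vsval w.1, w.2)).
rewrite linearD /= (projP_hyperbolic (hyperbolic_proj_mem _ _)) addr0.
rewrite val_center_lift => ->; rewrite /projP /= (surjective_pairing w).
congr (_, _); apply: val_inj; rewrite /= val_Pc.
by apply: center_projP; rewrite ?subvsP ?subrr ?mem0v.
Qed.

Lemma center_lift_projP (z : Xc) : center_lift (projP sigma f (vsval z)) = z.
Proof.
apply: val_inj; rewrite /= val_center_lift /= val_Pc.
apply: center_projP; first exact: subvsP.
rewrite (hyperbolic_space_DuGamma sigma f_diff) /= subrr eqxx andbT.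
rewrite -opprB rpredN sub_center_proj.
exact: hyperbolic_proj_mem.
Qed.

Lemma Pc_equivariant i x :
  Pc sigma f (Asigma sigma i x) = AsigmaWc i (Pc sigma f x).
Proof.
have JL := DGamma0_equivariant sigma_inj sigma_comp f_diff i.
apply: val_inj; rewrite /= val_Pc /AsigmaWc val_Pc.
rewrite (center_proj_intertwine JL) vsprojK //; exact: center_proj_mem.
Qed.

End CenterReduction.

(** * The reduced vector field *)

Section ReducedVectorField.
Variables (R : realType) (V : fdNormedModType R) (l N n : nat).
Variable sigma : 'I_n -> {ffun 'I_N -> 'I_N}.
Local Notation X := {ffun 'I_n -> V}.
Local Notation O := 'rV[R]_l.
Local Notation XO := ({ffun 'I_n -> V} * 'rV[R]_l)%type.
Hypothesis sigma_inj : injective sigma.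
Hypothesis sigma_comp :
  forall i j, exists k, sigma k = [ffun m => sigma i (sigma j m)].
Variable f : XO -> V.
Hypothesis f_diff : Ck 1 f.

Local Notation A := (DuGamma sigma f).
Local Notation L := (linearization (Gamma0 sigma f) 0).
Local Notation Wcf := (subvs_of (Wc sigma f)).
Local Notation Xc := (subvs_of (center_space A)).
Local Notation Xh := (subvs_of (hyperbolic_space A)).
Local Notation P := (projP sigma f).

Variable psi : Xc -> Xh.

Definition graph_point (z : Xc) : XO := vsval z + vsval (psi z).

(** The first component of [P \o uGamma], transported by the inverse [graph_point \o center_lift] of
    [P] on the graph of [psi]. *)
Definition reduced_field (w : Wcf * O) : Wcf :=
  Pc sigma f (Gamma sigma f (graph_point (center_lift w))).

Lemma projP_graph z : P (graph_point z) = P (vsval z).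
Proof.
by rewrite linearD /= [X in _ + X](projP_hyperbolic f_diff) ?addr0 // subvsP.
Qed.

Lemma center_lift_graph z : center_lift (P (graph_point z)) = z.
Proof. by rewrite projP_graph center_lift_projP. Qed.

Lemma projP_graph_lift w : P (graph_point (center_lift w)) = w.
Proof. by rewrite projP_graph projP_center_lift. Qed.

Lemma set_bij_projP : set_bij (range graph_point) setT P.
Proof.
split=> //.
- move=> _ _ /set_mem[z1 _ <-] /set_mem[z2 _ <-].
  move=> /(congr1 (@center_lift _ _ _ _ _ _ _)).
  by rewrite !center_lift_graph => ->.
- move=> w _; exists (graph_point (center_lift w)); last exact: projP_graph_lift.
  by exists (center_lift w).
Qed.

Lemma projP_uGamma z :
  P (uGamma sigma f (graph_point z)) = (reduced_field (P (graph_point z)), 0).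
Proof. by rewrite /reduced_field center_lift_graph. Qed.

Lemma reduced_field_Ck k : Ck k f -> Ck k psi -> Ck k reduced_field.
Proof.
move=> fC psiC.
exact: (pulled_back_Ck (vsval : {linear Xc -> XO}) (vsval : {linear Xh -> XO})
  (@center_lift _ _ _ _ _ sigma f : {linear (Wcf * O)%type -> Xc})
  (@Pc _ _ _ _ _ sigma f : {linear X -> Wcf}) (Gamma_Ck sigma fC) psiC).
Qed.

Hypotheses (psi_diff : Ck 1 psi) (psi0 : psi 0 = 0).
Hypothesis Dpsi0 : forall v, 'd psi 0 v = 0.

Lemma reduced_field0 : f (0, 0) = 0 -> reduced_field 0 = 0.
Proof.
move=> f0; rewrite /reduced_field linear0 /graph_point psi0 !linear0 addr0.
rewrite (_ : Gamma sigma f 0 = 0) ?linear0 //.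
by apply/ffunP => i; rewrite !ffunE (_ : Asigma _ _ _ = 0) // linear0.
Qed.

(** The derivative is [Pc] of [D Gamma (0)] applied to the lift of [(x, 0)]. That lift is some
    [(y, 0)] with [Pc y = x], so the derivative is [Pc (L y) = L (Pc y) = L x]. *)
Lemma linearization_reduced_field x :
  vsval (linearization (fun x => reduced_field (x, 0)) 0 x) = L (vsval x).
Proof.
pose J : {linear Wcf -> (Wcf * O)%type} := @pair0 Wcf O.
pose S : {linear (Wcf * O)%type -> Xc} := @center_lift _ _ _ _ _ sigma f.
pose SJ : {linear Wcf -> Xc} := S \o J.
pose Q : {linear X -> Wcf} := @Pc _ _ _ _ _ sigma f.
rewrite lfunE.
rewrite (_ : 'd _ 0 x = Q ('d (Gamma sigma f) 0 (vsval (SJ x)))); last first.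
  exact: (@diff_pulled_back _ _ _ _ _ _ _ (vsval : {linear Xc -> XO})
    (vsval : {linear Xh -> XO}) SJ Q _ _
    (Gamma_Ck sigma f_diff) psi_diff psi0 Dpsi0).
have zE : P (vsval (SJ x)) = (x, 0) by exact: projP_center_lift.
have -> : vsval (SJ x) = ((vsval (SJ x)).1, 0).
  by rewrite [LHS]surjective_pairing; congr (_, _); exact: (congr1 snd zE).
rewrite -(DGamma0E sigma f_diff) [LHS]val_Pc.
(* [L] commutes with itself, hence with its own center projection. *)
have /(center_proj_intertwine (J := L)) <- : forall y, L (L y) = L (L y) by [].
by rewrite -val_Pc; congr (L (vsval _)); exact: (congr1 fst zE).
Qed.

(** The inclusion of [W_c] is injective, intertwines this linearization with [L], and takes its
    values in the center space of [L]. *)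
Lemma center_space_reduced_field :
  center_space (linearization (fun x => reduced_field (x, 0)) 0) = fullv%VS.
Proof.
apply/vspaceP => x; rewrite memvf.
apply: (spectral_space_intertwine_inj linearization_reduced_field).
- exact: imaginary_conj.
- exact: val_inj.
- exact: subvsP.
Qed.

Lemma reduced_field_equivariant i x lambda :
  (forall z, exists z', graph_point z' = AsigmaO sigma i (graph_point z)) ->
  vsval (reduced_field (AsigmaWc i x, lambda)) =
  Asigma sigma i (vsval (reduced_field (x, lambda))).
Proof.
move=> /(_ (center_lift (x, lambda)))[z' z'E].
(* The image of the graph point over [(x, lambda)] is again a graph point, and it is the one over
   [(A_sigma x, lambda)]; so the reduced field there is read off from [Gamma] at the image. *)
have Pz' : P (graph_point z') = (AsigmaWc i x, lambda).
  rewrite z'E /projP /AsigmaO /= (Pc_equivariant sigma_inj sigma_comp f_diff).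
  by have [-> ->] := projP_graph_lift (x, lambda).
rewrite /reduced_field -Pz' center_lift_graph z'E.
rewrite (Gamma_equivariant sigma_inj sigma_comp).
rewrite (Pc_equivariant sigma_inj sigma_comp f_diff).
rewrite /AsigmaWc vsprojK // val_Pc.
have JL := DGamma0_equivariant sigma_inj sigma_comp f_diff i.
rewrite (center_proj_intertwine JL).
exact: center_proj_mem.
Qed.

End ReducedVectorField.

(** * Conjugacy on the center manifold *)

Theorem theorem5p1 (R : realType) (V : fdNormedModType R) (l N n : nat)
    (n_gt0 : (0 < n)%N) (sigma : 'I_n -> {ffun 'I_N -> 'I_N})
    (sigma_inj : injective sigma)
    (sigma_id : sigma (Ordinal n_gt0) = [ffun m => m])
    (sigma_comp : forall i j, exists k, sigma k = [ffun m => sigma i (sigma j m)])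
    (k : nat) (k_gt0 : (1 <= k)%N)
    (f : {ffun 'I_n -> V} * 'rV[R]_l -> V)
    (f_Ck : Ck k f) (f0 : f (0, 0) = 0)
    (eps : R)
    (eps_cst : center_manifold_constant (DuGamma sigma f) k eps)
    (f_cm : center_manifold_conditions
              (DuGamma sigma f) k eps (uGamma sigma f)) :
  let Mc := center_manifold (DuGamma sigma f) (uGamma sigma f) in
  let P := projP sigma f in
  exists Rf : subvs_of (Wc sigma f) * 'rV[R]_l -> subvs_of (Wc sigma f),
    [/\ (* P restricted to Mc conjugates uGamma to the ODE given by Rf *)
        set_bij Mc setT P
        /\ (forall x, Mc x -> P (uGamma sigma f x) = (Rf (P x), 0)),
        Ck k Rf,
        Rf (0, 0) = 0,
        center_space (linearization (fun x => Rf (x, 0)) 0) = fullv%VS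
      & forall (i : 'I_n) (x : subvs_of (Wc sigma f)) (lambda : 'rV[R]_l),
          vsval (Rf (AsigmaWc i x, lambda)) = Asigma sigma i (vsval (Rf (x, lambda)))].
Proof.
move=> Mc P.
have f_diff := Ck_le k_gt0 f_Ck.
have [_ /(_ _ f_cm)[psi [psiC psi0 Dpsi0 McE]]] := eps_cst.
have psi_diff := Ck_le k_gt0 psiC.
exists (reduced_field psi); split.
- rewrite /Mc McE; split; first exact: set_bij_projP.
  by move=> _ [z _ <-]; exact: projP_uGamma.
- exact: reduced_field_Ck.
- exact: reduced_field0.
- exact: center_space_reduced_field.
move=> i x lambda; apply: reduced_field_equivariant => // z.
(* Invariance of the graph comes from its dynamical description by orbits with bounded hyperbolic
   component, not from [psi] itself. *)
have Mcz : Mc (graph_point psi z) by rewrite /Mc McE; exists z.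
have : Mc (AsigmaO sigma i (graph_point psi z)).
  apply: center_manifold_equivariant Mcz; first exact: uGamma_equivariant.
  exact: DuGamma_equivariant.
by rewrite /Mc McE => -[z' _ <-]; exists z'.
Qed.
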